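(* Let $N\ge 1$ and let $f:[0,1]\to\mathbb{R}$ be continuous and strictly increasing. Then the quasimetric space $(\Delta_N,D_f)$ is geodesic, i.e. for every $P,Q\in\Delta_N$ there is an f-geodesic from $P$ to $Q$. Moreover, if $m\in\{1,2,\dots\}$ and $f\in C^m(0,1)$ with $f'$ positive on $(0,1)$, then any $P,Q\in\Delta_N^\circ$ can be connected by an f-geodesic (from $P$ to $Q$) that is of class $C^m$.
   Context: $\Delta_N=\{P=(p_0,\dots,p_N)\in[0,1]^{N+1} : \sum_i p_i=1\}$ is the $N$-dimensional probability simplex in $\mathbb{R}^{N+1}$, and $\Delta_N^\circ$ is its (relative) interior, i.e. the points with all $p_i>0$. For a continuous strictly increasing $f:[0,1]\to\mathbb{R}$ one sets $D_f(P,Q)=\max_{0\le i\le N}\big(f(q_i)-f(p_i)\big)$; this is a quasimetric on $\Delta_N$ (nonnegative, zero exactly when $P=Q$, satisfying the triangle inequality, not necessarily symmetric) which induces the Euclidean topology. (Without loss of generality $f$ may be rescaled affinely so that $f(0)=0$, $f(1)=1$; this only multiplies $D_f$ by a positive constant.) An f-geodesic (forward geodesic) from $P$ to $Q$ is a curve (continuous map) $\gamma:[a,b]\to\Delta_N$ with $a\le b$ (the degenerate interval $a=b$ being allowed, which covers the case $P=Q$), $\gamma(a)=P$, $\gamma(b)=Q$, such that $D_f(\gamma(s),\gamma(t))=t-s$ for all $s,t\in[a,b]$ with $s\le t$. Class $C^m$ refers to $\gamma$ as a map from the closed interval $[a,b]$ into $\mathbb{R}^{N+1}$. *)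

(* Defs.v *)
From HB Require Import structures.
From mathcomp Require Import all_boot all_order all_algebra.
From mathcomp Require Import all_classical all_reals all_analysis.

Set Implicit Arguments.
Unset Strict Implicit.
Unset Printing Implicit Defensive.

Import Order.TTheory GRing.Theory Num.Theory.
Import numFieldNormedType.Exports.

Local Open Scope classical_set_scope.
Local Open Scope ring_scope.

(* A function on [0,1] (resp. a curve on [a,b]) is a total function on R; only
   its restriction to the interval matters.  The topology of 'rV[R]_N.+1 is that
   of the sup norm, i.e., the Euclidean topology. *)

Definition simplex (R : realType) (N : nat) : set 'rV[R]_N.+1 :=
  [set P : 'rV[R]_N.+1 | (forall i, P 0 i \in `[0, 1]) /\ \sum_(i < N.+1) P 0 i = 1].

Definition simplex_interior (R : realType) (N : nat) : set 'rV[R]_N.+1 :=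
  [set P : 'rV[R]_N.+1 | simplex P /\ forall i, 0 < P 0 i].

(* R has no least element, so the maximum is started at its own term of index 0. *)
Definition Df (R : realType) (f : R -> R) (N : nat) (P Q : 'rV[R]_N.+1) : R :=
  \big[Num.max/f (Q 0 ord0) - f (P 0 ord0)]_(i < N.+1) (f (Q 0 i) - f (P 0 i)).

Definition fgeodesic (R : realType) (f : R -> R) (N : nat) (a b : R)
    (g : R -> 'rV[R]_N.+1) (P Q : 'rV[R]_N.+1) : Prop :=
  [/\ a <= b,
      {within `[a, b], continuous g},
      (forall t, t \in `[a, b] -> simplex (g t)),
      g a = P /\ g b = Q &
      forall s t, s \in `[a, b] -> t \in `[a, b] -> s <= t ->
        Df f (g s) (g t) = t - s].

Definition Cm_01 (R : realType) (m : nat) (f : R -> R) : Prop :=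
  (forall k, (k < m)%N -> {in `]0, 1[, forall x, derivable (f^`(k))%classic x 1}) /\
  {in `]0, 1[, continuous (f^`(m))%classic}.

(* Limits of difference quotients are taken along points of A only, so the
   derivative is one-sided at an endpoint of a closed interval A.  At an isolated
   point of A (the case A = [a,a]) every value is a derivative. *)
Definition is_derivative_on (R : realType) (V : normedModType R) (A : set R)
    (g dg : R -> V) : Prop :=
  forall x, A x ->
    (fun y => (y - x)^-1 *: (g y - g x)) @ (within A x^') --> dg x.

Fixpoint Cm_on (R : realType) (V : normedModType R) (A : set R) (m : nat)
    (g : R -> V) : Prop :=
  if m is k.+1 then exists dg : R -> V, is_derivative_on A g dg /\ Cm_on A k dg
  else {within A, continuous g}.

(* Main.v *)
(* Work in the coordinates u_i = f(p_i), v_i = f(q_i) and put D = D_f(P, Q),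
   F = f^-1.  A coordinate with p_i <= q_i moves at constant speed in f-scale,
   as F(u_i + (t/D)(v_i - u_i)); its speed is at most 1, and exactly 1 for the
   coordinate realizing D.  A coordinate with q_i < p_i follows
   F(u_i + l(t/D)(v_i - u_i)) for a common nondecreasing l : [0,1] -> [0,1], so it
   never contributes to the maximum.  The rising coordinates gain mass
   monotonically and the falling ones lose it strictly monotonically in l, with
   equal totals over [0,1], so a unique l(s) keeps the coordinates summing to 1.
   Every coordinate stays between p_i and q_i, hence in ]0,1[ for interior points,
   and there l is the composition of a C^m map with the inverse of a C^m map of
   positive derivative. *)

Require Import Defs.
From mathcomp Require Import all_boot all_order all_algebra.
From mathcomp Require Import all_classical all_reals all_analysis.
From mathcomp Require Import ring lra.
Import Order.TTheory GRing.Theory Num.Theory.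
Import numFieldNormedType.Exports.
Local Open Scope classical_set_scope.
Local Open Scope ring_scope.

Set Implicit Arguments.
Unset Strict Implicit.
Unset Printing Implicit Defensive.

(** * Derivatives relative to a set of reals *)

(** The filter [within A (nbhs x)] keeps the point [x] itself, so [h y = h x] does no harm, unlike
    with punctured neighbourhoods. *)
Lemma cvg_within_comp (T U V : topologicalType) (A : set T) (B : set U)
    (h : T -> U) (k : U -> V) (x : T) (l : V) :
  (forall y, A y -> B (h y)) -> h @ within A (nbhs x) --> h x ->
  k @ within B (nbhs (h x)) --> l -> (k \o h) @ within A (nbhs x) --> l.
Proof.
move=> hAB hc kc W Wl.
have WB : nbhs (h x) [set z | B z -> W (k z)] by exact: kc W Wl.
have := hc _ WB; rewrite /fmap /nbhs /= /within /=.
by apply: filterS => y /= H Ay; exact: H Ay (hAB _ Ay).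
Qed.

(* Caratheodory's form, which also covers isolated points of A, where q x may be
   any value; it turns the rules of calculus into algebraic identities for q. *)
Lemma is_derivative_onP (R : realType) (A : set R) (g dg : R -> R) :
  is_derivative_on A g dg <-> forall x, A x -> exists q : R -> R,
    [/\ q x = dg x, q @ within A (nbhs x) --> q x &
        forall y, A y -> g y - g x = q y * (y - x)].
Proof.
split=> H x Ax.
(* The difference quotient, completed at [x] by its limit. *)
- exists (fun y => if y == x then dg x else (y - x)^-1 * (g y - g x)); split.
  + by rewrite eqxx.
  + rewrite eqxx => W dW.
    have HW : nbhs x [set y | y != x -> A y -> W ((y - x)^-1 *: (g y - g x))].
      exact: H x Ax W dW.
    apply: (filterS _ HW) => y /= Hy Ay; case: eqP => [_|/eqP nyx].
      exact: nbhs_singleton dW.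
    exact: Hy.
  + move=> y Ay; case: eqP => [->|/eqP nyx]; first by rewrite !subrr mulr0.
    by rewrite mulrC mulrA divff ?mul1r // subr_eq0.
- have [q [qx qc qE]] := H x Ax; move=> W dW.
  have HW : nbhs x [set y | A y -> W (q y)] by apply: qc; rewrite qx.
  apply: (filterS _ HW) => y /= Hy nyx Ay.
  by rewrite /= qE // mulrC scalerA mulVf ?scale1r ?subr_eq0 //; exact: Hy.
Qed.

Lemma is_derivative_on_continuous (R : realType) (A : set R) (g dg : R -> R) (x : R) :
  is_derivative_on A g dg -> A x -> g @ within A (nbhs x) --> g x.
Proof.
move=> /is_derivative_onP H Ax; have [q [_ qc qE]] := H x Ax.
have gE : {in A, (fun y => g x + q y * (y - x)) =1 g}.
  by move=> y /set_mem Ay; rewrite -qE // addrC subrK.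
apply: cvg_trans (_ : (fun y => g x + q y * (y - x)) @ within A (nbhs x) --> g x).
  by apply: fmap_within_eq => y yA; rewrite gE.
rewrite -[X in _ --> X]addr0 -[X in _ + X](mulr0 (q x)) -[X in _ * X](subrr x).
apply: cvgD; first exact: cvg_cst.
apply: cvgM => //; apply: cvgB; last exact: cvg_cst.
exact: cvg_within.
Qed.

Lemma is_derivative_on_cst (R : realType) (A : set R) (c : R) :
  is_derivative_on A (fun=> c) (fun=> 0).
Proof.
apply/is_derivative_onP => x _; exists (fun=> 0); split=> //.
- exact: cvg_cst.
- by move=> y _; rewrite subrr mul0r.
Qed.

Lemma is_derivative_on_id (R : realType) (A : set R) :
  is_derivative_on A (fun x : R => x) (fun=> 1 : R).
Proof.
apply/is_derivative_onP => x _; exists (fun=> 1); split=> //.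
- exact: cvg_cst.
- by move=> y _; rewrite mul1r.
Qed.

Lemma is_derivative_onD (R : realType) (A : set R) (g dg h dh : R -> R) :
  is_derivative_on A g dg -> is_derivative_on A h dh ->
  is_derivative_on A (fun x => g x + h x) (fun x => dg x + dh x).
Proof.
move=> /is_derivative_onP gP /is_derivative_onP hP.
apply/is_derivative_onP => x Ax.
have [q [qx qc qE]] := gP x Ax; have [r [rx rc rE]] := hP x Ax.
exists (fun y => q y + r y); split; [by rewrite qx rx|exact: cvgD|].
by move=> y Ay; rewrite mulrDl -qE // -rE // opprD addrACA.
Qed.

Lemma is_derivative_onM (R : realType) (A : set R) (g dg h dh : R -> R) :
  is_derivative_on A g dg -> is_derivative_on A h dh ->
  is_derivative_on A (fun x => g x * h x) (fun x => dg x * h x + g x * dh x).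
Proof.
move=> gD hD; have /is_derivative_onP gP := gD; have /is_derivative_onP hP := hD.
apply/is_derivative_onP => x Ax.
have [q [qx qc qE]] := gP x Ax; have [r [rx rc rE]] := hP x Ax.
(* From g(y)h(y) - g(x)h(x) = (g(y) - g(x))h(x) + g(y)(h(y) - h(x)). *)
exists (fun y => q y * h x + g y * r y); split; first by rewrite qx rx.
  apply: cvgD; apply: cvgM => //; first exact: cvg_cst.
  exact: is_derivative_on_continuous gD Ax.
move=> y Ay; rewrite mulrDl mulrAC -qE // -mulrA -rE //.
by rewrite mulrBl mulrBr [RHS]addrC addrA subrK.
Qed.

Lemma is_derivative_on_inv (R : realType) (A : set R) (g dg : R -> R) :
  (forall x, A x -> g x != 0) -> is_derivative_on A g dg ->
  is_derivative_on A (fun x => (g x)^-1)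
    (fun x => - dg x * ((g x)^-1 * (g x)^-1)).
Proof.
move=> g0 gD; have /is_derivative_onP gP := gD.
apply/is_derivative_onP => x Ax; have [q [qx qc qE]] := gP x Ax.
exists (fun y => - q y * ((g y)^-1 * (g x)^-1)); split; first by rewrite qx.
  apply: cvgM; first exact: cvgN.
  apply: cvgM; last exact: cvg_cst.
  by apply: cvgV; [exact: g0|exact: is_derivative_on_continuous gD Ax].
move=> y Ay; have := qE y Ay => /(congr1 -%R); rewrite opprB -mulNr => e.
by rewrite mulrAC -e; field; rewrite !g0.
Qed.

(** The increment of the composite factors as [q (h y) * r y * (y - x)] without any division, so
    points with [h y = h x] need no separate case. *)
Lemma is_derivative_on_comp (R : realType) (A B : set R) (g dg h dh : R -> R) :
  (forall x, B x -> A (h x)) -> is_derivative_on A g dg ->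
  is_derivative_on B h dh ->
  is_derivative_on B (fun x => g (h x)) (fun x => dg (h x) * dh x).
Proof.
move=> hBA /is_derivative_onP gP hD; have /is_derivative_onP hP := hD.
apply/is_derivative_onP => x Bx; have [r [rx rc rE]] := hP x Bx.
have [q [qx qc qE]] := gP (h x) (hBA x Bx).
exists (fun y => q (h y) * r y); split; first by rewrite qx rx.
  apply: cvgM => //; apply: (@cvg_within_comp _ _ _ B A h q x _ hBA _ qc).
  exact: is_derivative_on_continuous hD Bx.
by move=> y By; rewrite qE; [rewrite rE // mulrA|exact: hBA].
Qed.

(** The quotient of [h] is the reciprocal of that of [g], taken at [h y]; it converges because [h]
    is continuous and [dg] does not vanish. *)
Lemma is_derivative_on_can (R : realType) (A B : set R) (g dg h : R -> R) :
  (forall y, B y -> A (h y)) -> (forall y, B y -> g (h y) = y) ->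
  {within B, continuous h} -> is_derivative_on A g dg ->
  (forall x, A x -> dg x != 0) ->
  is_derivative_on B h (fun y => (dg (h y))^-1).
Proof.
move=> hBA hK /subspace_continuousP hc /is_derivative_onP gP dg0.
apply/is_derivative_onP => x Bx; have [q [qx qc qE]] := gP (h x) (hBA x Bx).
have qh y : B y -> y - x = q (h y) * (h y - h x).
  by move=> By; rewrite -qE ?hK //; exact: hBA.
exists (fun y => (q (h y))^-1); split; first by rewrite qx.
  apply: cvgV; first by rewrite qx; exact: dg0 (hBA _ Bx).
  exact: (@cvg_within_comp _ _ _ B A h q x _ hBA (hc x Bx) qc).
(* If [q (h y)] is 0, then [qh] forces [y = x] and both sides vanish. *)
move=> y By; have [q0|q0] := eqVneq (q (h y)) 0; last first.
  by rewrite qh // mulKf.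
have := qh y By; rewrite q0 mul0r => /eqP; rewrite subr_eq0 => /eqP ->.
by rewrite !subrr mulr0.
Qed.

(** * Closure properties of the class C^m on a set *)

Lemma Cm_on_continuous (R : realType) (A : set R) (m : nat) (g : R -> R) :
  Cm_on A m g -> {within A, continuous g}.
Proof.
case: m => //= m [dg [gD _]]; apply/subspace_continuousP => x Ax.
exact: is_derivative_on_continuous gD Ax.
Qed.

Lemma Cm_onW (R : realType) (A : set R) (m : nat) (g : R -> R) :
  Cm_on A m.+1 g -> Cm_on A m g.
Proof.
elim: m g => [|m IH] g [dg [gD dgC]].
  by apply: (@Cm_on_continuous _ _ 1); exists dg.
by exists dg; split=> //; exact: IH.
Qed.

Lemma Cm_on_cst (R : realType) (A : set R) (m : nat) (c : R) :
  Cm_on A m (fun=> c).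
Proof.
elim: m c => [|m IH] c; first by move=> x; exact: cvg_cst.
by exists (fun=> 0); split; [exact: is_derivative_on_cst|exact: IH].
Qed.

Lemma Cm_on_id (R : realType) (A : set R) (m : nat) :
  Cm_on A m (fun x : R => x).
Proof.
case: m => [|m].
  by apply/subspace_continuousP => x _; exact: cvg_within.
by exists (fun=> 1); split; [exact: is_derivative_on_id|exact: Cm_on_cst].
Qed.

Lemma Cm_onD (R : realType) (A : set R) (m : nat) (g h : R -> R) :
  Cm_on A m g -> Cm_on A m h -> Cm_on A m (fun x => g x + h x).
Proof.
elim: m g h => [|m IH] g h.
  move=> /subspace_continuousP gc /subspace_continuousP hc.
  by apply/subspace_continuousP => x Ax; apply: cvgD; [exact: gc|exact: hc].
move=> [dg [gD dgC]] [dh [hD dhC]]; exists (fun x => dg x + dh x).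
by split; [exact: is_derivative_onD|exact: IH].
Qed.

Lemma Cm_onM (R : realType) (A : set R) (m : nat) (g h : R -> R) :
  Cm_on A m g -> Cm_on A m h -> Cm_on A m (fun x => g x * h x).
Proof.
elim: m g h => [|m IH] g h.
  move=> /subspace_continuousP gc /subspace_continuousP hc.
  by apply/subspace_continuousP => x Ax; apply: cvgM; [exact: gc|exact: hc].
move=> gC hC; have [dg [gD dgC]] := gC; have [dh [hD dhC]] := hC.
exists (fun x => dg x * h x + g x * dh x); split; first exact: is_derivative_onM.
(* The derivative contains [g] and [h] themselves, which are lowered by one class to fit the
   induction hypothesis. *)
by apply: Cm_onD; apply: IH => //; exact: Cm_onW.
Qed.

Lemma Cm_onN (R : realType) (A : set R) (m : nat) (g : R -> R) :
  Cm_on A m g -> Cm_on A m (fun x => - g x).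
Proof.
move=> gC; have -> : (fun x => - g x) = (fun x => -1 * g x).
  by apply/funext => x; rewrite mulN1r.
by apply: Cm_onM => //; exact: Cm_on_cst.
Qed.

Lemma Cm_on_sum (R : realType) (A : set R) (m : nat) (I : Type) (r : seq I)
    (p : pred I) (g : I -> R -> R) :
  (forall i, p i -> Cm_on A m (g i)) ->
  Cm_on A m (fun x => \sum_(i <- r | p i) g i x).
Proof.
move=> gC; elim: r => [|i r IH].
  have -> : (fun x => \sum_(i <- [::] | p i) g i x) = (fun=> 0 : R).
    by apply/funext => x; rewrite big_nil.
  exact: Cm_on_cst.
have [pi|npi] := boolP (p i).
  have -> : (fun x => \sum_(j <- i :: r | p j) g j x) =
      (fun x => g i x + \sum_(j <- r | p j) g j x).
    by apply/funext => x; rewrite big_cons pi.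
  by apply: Cm_onD => //; exact: gC.
have -> : (fun x => \sum_(j <- i :: r | p j) g j x) =
    (fun x => \sum_(j <- r | p j) g j x).
  by apply/funext => x; rewrite big_cons (negbTE npi).
exact: IH.
Qed.

Lemma Cm_on_inv (R : realType) (A : set R) (m : nat) (g : R -> R) :
  (forall x, A x -> g x != 0) -> Cm_on A m g -> Cm_on A m (fun x => (g x)^-1).
Proof.
move=> g0; elim: m => [|m IH].
  move=> /subspace_continuousP gc; apply/subspace_continuousP => x Ax.
  by apply: cvgV; [exact: g0|exact: gc].
move=> gC; have [dg [gD dgC]] := gC.
exists (fun x => - dg x * ((g x)^-1 * (g x)^-1)); split.
  exact: is_derivative_on_inv.
(* The derivative of 1/g involves 1/g again, one class lower, which is the induction hypothesis. *)
have giC := IH (Cm_onW gC).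
by apply: Cm_onM; [exact: Cm_onN|exact: Cm_onM].
Qed.

Lemma Cm_on_comp (R : realType) (A B : set R) (m : nat) (g h : R -> R) :
  (forall x, B x -> A (h x)) -> Cm_on A m g -> Cm_on B m h ->
  Cm_on B m (fun x => g (h x)).
Proof.
move=> hBA; elim: m g => [|m IH] g.
  move=> /subspace_continuousP gc /subspace_continuousP hc.
  apply/subspace_continuousP => x Bx.
  exact: (@cvg_within_comp _ _ _ B A h g x _ hBA (hc x Bx) (gc _ (hBA x Bx))).
move=> [dg [gD dgC]] hC; have [dh [hD dhC]] := hC.
exists (fun x => dg (h x) * dh x); split; first exact: (is_derivative_on_comp hBA).
by apply: Cm_onM => //; apply: IH => //; exact: Cm_onW.
Qed.

(** * Positive derivatives, inverses, and vector-valued curves *)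

(** For [m = 0] positivity is dropped and only continuity remains, so that one construction serves
    both halves of the theorem. *)
Definition Cm_pos_on (R : realType) (A : set R) (m : nat) (g : R -> R) : Prop :=
  if m is k.+1 then exists dg : R -> R,
    [/\ is_derivative_on A g dg, Cm_on A k dg & forall x, A x -> 0 < dg x]
  else {within A, continuous g}.

Lemma Cm_pos_onW (R : realType) (A : set R) (m : nat) (g : R -> R) :
  Cm_pos_on A m g -> Cm_on A m g.
Proof. by case: m => //= m [dg [gD dgC _]]; exists dg. Qed.

(** Bootstrapping on h' = 1/(g' o h): if [h] is of some class not above that of g', so is h', and
    [h] gains one class. Continuity of [h] starts the induction. *)
Lemma Cm_pos_on_can (R : realType) (A B : set R) (m : nat) (g h : R -> R) :
  (forall y, B y -> A (h y)) -> (forall y, B y -> g (h y) = y) ->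
  {within B, continuous h} -> Cm_pos_on A m g -> Cm_pos_on B m h.
Proof.
move=> hBA hK hc; case: m => // m [dg [gD dgC dg0]].
have dgn0 x : A x -> dg x != 0 by move=> /dg0 /lt0r_neq0.
have hD := is_derivative_on_can hBA hK hc gD dgn0.
exists (fun y => (dg (h y))^-1); split=> //; last first.
  by move=> y By; rewrite invr_gt0; exact: dg0 (hBA _ By).
suff hC : Cm_on B m h.
  apply: Cm_on_inv; first by move=> y By; exact: dgn0 (hBA _ By).
  exact: Cm_on_comp hBA dgC hC.
elim: m dgC => // m IH dgC; exists (fun y => (dg (h y))^-1); split=> //.
apply: Cm_on_inv; first by move=> y By; exact: dgn0 (hBA _ By).
exact: Cm_on_comp hBA (Cm_onW dgC) (IH (Cm_onW dgC)).
Qed.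

(** Expanding a row in the basis [delta_mx 0 i] reduces vector limits to finite sums of scalar
    limits times fixed vectors. *)
Lemma Cm_on_row (R : realType) (A : set R) (n m : nat) (g : 'I_n -> R -> R) :
  (forall i, Cm_on A m (g i)) -> Cm_on A m (fun t => \row_i g i t : 'rV[R]_n).
Proof.
have rowE t (h : 'I_n -> R -> R) :
    \row_i h i t = \sum_i h i t *: delta_mx 0 i :> 'rV[R]_n.
  by rewrite [LHS]row_sum_delta; apply: eq_bigr => i _; rewrite mxE.
elim: m g => [|m IH] g gC.
  have -> : (fun t => \row_i g i t) =
      (fun t => \sum_i g i t *: delta_mx 0 i) :> (R -> 'rV[R]_n).
    by apply/funext => t; exact: rowE.
  apply/subspace_continuousP => x Ax; apply: cvg_big => [|i _]; first exact: add_continuous.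
  apply: cvgZr_tmp; have /subspace_continuousP := gC i; exact.
have [dg dgP] := choice gC; exists (fun t => \row_i dg i t); split; last first.
  by apply: IH => i; have [] := dgP i.
move=> x Ax; rewrite (rowE x dg).
rewrite [X in X @ _ --> _](_ : _ = fun y =>
    \sum_i ((y - x)^-1 *: (g i y - g i x)) *: (delta_mx 0 i : 'rV[R]_n)); last first.
  apply/funext => y; rewrite !rowE -sumrB scaler_sumr; apply: eq_bigr => i _.
  by rewrite -scalerBl scalerA.
apply: cvg_big => [|i _]; first exact: add_continuous.
by apply: cvgZr_tmp; have [/(_ x Ax)] := dgP i.
Qed.

Lemma is_derivative_onN (R : realType) (A : set R) (g dg : R -> R) :
  is_derivative_on A g dg -> is_derivative_on A (fun x => - g x) (fun x => - dg x).
Proof.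
move=> /is_derivative_onP gP; apply/is_derivative_onP => x Ax.
have [q [qx qc qE]] := gP x Ax; exists (fun y => - q y).
split; [by rewrite qx|exact: cvgN|by move=> y Ay; rewrite mulNr -qE // opprD].
Qed.

Lemma is_derivative_on_sum (R : realType) (A : set R) (I : Type) (r : seq I)
    (p : pred I) (g dg : I -> R -> R) :
  (forall i, p i -> is_derivative_on A (g i) (dg i)) ->
  is_derivative_on A (fun x => \sum_(i <- r | p i) g i x)
    (fun x => \sum_(i <- r | p i) dg i x).
Proof.
move=> gD; elim: r => [|i r IH].
  have E (h : I -> R -> R) : (fun x => \sum_(i <- [::] | p i) h i x) = (fun=> 0).
    by apply/funext => x; rewrite big_nil.
  rewrite !E; exact: is_derivative_on_cst.
have E (h : I -> R -> R) : (fun x => \sum_(j <- i :: r | p j) h j x) =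
    (fun x => (if p i then h i x else 0) + \sum_(j <- r | p j) h j x).
  by apply/funext => x; rewrite big_cons; case: (p i); rewrite ?add0r.
rewrite !E; apply: is_derivative_onD => //.
by case: (boolP (p i)) => [/gD//|_]; exact: is_derivative_on_cst.
Qed.

Lemma is_derivative_on_affine (R : realType) (A : set R) (u c : R) :
  is_derivative_on A (fun s => u + s * c) (fun=> c).
Proof.
apply/is_derivative_onP => x _; exists (fun=> c); split=> //.
- exact: cvg_cst.
- by move=> y _; ring.
Qed.

Lemma Cm_on_affine (R : realType) (A : set R) (m : nat) (u c : R) :
  Cm_on A m (fun s => u + s * c).
Proof.
apply: Cm_onD; first exact: Cm_on_cst.
by apply: Cm_onM; [exact: Cm_on_id|exact: Cm_on_cst].
Qed.

(** Meant for falling coordinates: the sign of [c] and the outer minus cancel, leaving a positive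
    derivative. *)
Lemma Cm_pos_on_comp_affine (R : realType) (A B : set R) (m : nat)
    (g : R -> R) (u c : R) :
  (forall s, B s -> A (u + s * c)) -> c < 0 -> Cm_pos_on A m g ->
  Cm_pos_on B m (fun s => - g (u + s * c)).
Proof.
move=> BA c0; case: m => [|m] /=.
  move=> gC; apply: (@Cm_onN _ _ 0).
  by apply: (@Cm_on_comp _ A _ 0) => //; exact: (@Cm_on_affine _ _ 0).
move=> [dg [gD dgC dg0]]; exists (fun s => - (dg (u + s * c) * c)); split.
- apply: is_derivative_onN.
  by apply: (is_derivative_on_comp BA) => //; exact: is_derivative_on_affine.
- apply: Cm_onN; apply: Cm_onM; last exact: Cm_on_cst.
  by apply: (Cm_on_comp BA) => //; exact: Cm_on_affine.
- by move=> s /BA/dg0 dgs; rewrite oppr_gt0 pmulr_rlt0.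
Qed.

(** A selected index must exist because an empty sum has derivative 0. *)
Lemma Cm_pos_on_sum (R : realType) (A : set R) (m : nat) (I : finType)
    (p : pred I) (g : I -> R -> R) :
  (exists i, p i) -> (forall i, p i -> Cm_pos_on A m (g i)) ->
  Cm_pos_on A m (fun x => \sum_(i | p i) g i x).
Proof.
move=> [i0 pi0]; case: m => [|m] gC; first exact: (@Cm_on_sum _ _ 0).
have /choice[dg dgP] : forall i, exists dg : R -> R, p i ->
    [/\ is_derivative_on A (g i) dg, Cm_on A m dg & forall x, A x -> 0 < dg x].
  move=> i; have [/gC[dg dgP]|_] := boolP (p i); first by exists dg.
  by exists (fun=> 0).
exists (fun x => \sum_(i | p i) dg i x); split.
- by apply: is_derivative_on_sum => i /dgP[].
- by apply: Cm_on_sum => i /dgP[].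
- move=> x Ax; rewrite (bigD1 i0) //=; apply: ltr_wpDr.
    by apply: sumr_ge0 => i /andP[/dgP[_ _ /(_ x Ax)/ltW]].
  by have [_ _ /(_ x Ax)] := dgP _ pi0.
Qed.

(** * Continuous inverses and the balancing of rising and falling mass *)

Lemma increasing_inverse (R : realType) (a b : R) (f : R -> R) :
  a <= b -> {within `[a, b], continuous f} ->
  {in `[a, b] &, {homo f : x y / x < y}} ->
  exists h : R -> R,
    [/\ {in `[a, b], cancel f h}, {in `[f a, f b], cancel h f},
        {in `[f a, f b], forall y, h y \in `[a, b]},
        {in `[f a, f b] &, {homo h : x y / x < y}} &
        {within `[f a, f b], continuous h}].
Proof.
move=> ab fc fI.
have fle : {in `[a, b] &, {mono f : x y / x <= y}} by exact: le_mono_in.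
(* Some preimage of [y], with default [a] where there is none; on the range of [f] the intermediate
   value theorem provides one. *)
pose h y := xget a [set x | x \in `[a, b] /\ f x = y].
have hP y : y \in `[f a, f b] -> h y \in `[a, b] /\ f (h y) = y.
  rewrite in_itv /= => /andP[fay yfb].
  rewrite /h; case: xgetP => [x _ //|].
  have [|c cab <- /(_ c)] := IVT ab fc (v := y).
    by rewrite ge_min fay /= le_max yfb orbT.
  by case.
have fK : {in `[a, b], cancel f h}.
  move=> x xab; have : f x \in `[f a, f b].
    by move: (xab); rewrite !in_itv /= => /andP[ax xb]; rewrite !fle ?in_itv /= ?lexx ?ab ?ax ?xb.
  by move=> /hP[hab /(inc_inj_in fle)]; apply.
exists h; split=> //.
- by move=> y /hP[].
- by move=> y /hP[].
- move=> y z /hP[hy fhy] /hP[hz fhz] yz; rewrite ltNge; apply/negP.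
  by rewrite -fle // fhy fhz leNgt yz.
- exact: segment_can_le_continuous ab fc fK.
Qed.

(* p selects the rising coordinates; the falling ones are slaved to lam. *)
Lemma balancing_time (R : realType) (n m : nat) (p : pred 'I_n)
    (G : 'I_n -> R -> R) :
  (forall i, p i -> Cm_on `[0, 1] m (G i)) ->
  (forall i, ~~ p i -> Cm_pos_on `[0, 1] m (fun s => - G i s)) ->
  (forall i, p i -> {in `[0, 1] &, {homo G i : s t / s <= t}}) ->
  (forall i, ~~ p i -> {in `[0, 1] &, {homo G i : s t /~ s < t}}) ->
  (exists i, ~~ p i) -> \sum_i G i 0 = \sum_i G i 1 ->
  exists lam : R -> R,
    [/\ Cm_on `[0, 1] m lam, lam 0 = 0 /\ lam 1 = 1,
        {in `[0, 1], forall s, lam s \in `[0, 1]},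
        {in `[0, 1] &, {homo lam : s t / s <= t}} &
        {in `[0, 1], forall s,
          \sum_i G i (if p i then s else lam s) = \sum_i G i 0}].
Proof.
move=> pC nC pI nI [i0 ni0] G01.
have i01 : (0 : R) \in `[0, 1] by rewrite in_itv /= lexx ler01.
have i11 : (1 : R) \in `[0, 1] by rewrite in_itv /= lexx ler01.
(* The balance equation splits into [A s = B t], with the rising coordinates in [A] and the falling
   ones in [B]; hence [lam] is to be the inverse of [B] after [A]. *)
pose A s := \sum_(i | p i) G i s - \sum_i G i 0.
pose B s := \sum_(i | ~~ p i) (- G i s).
have AB s t : A s = B t <-> \sum_i G i (if p i then s else t) = \sum_i G i 0.
  have -> : \sum_i G i (if p i then s else t) =
      \sum_(i | p i) G i s + \sum_(i | ~~ p i) G i t.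
    rewrite (bigID p) /=; congr (_ + _); apply: eq_bigr => i; first by move=> ->.
    by move=> /negbTE ->.
  by rewrite /A /B sumrN; split=> H; lra.
have BC : Cm_pos_on `[0, 1] m B by apply: Cm_pos_on_sum => //; exists i0.
(* Strictness comes from the falling index [i0]. *)
have BI : {in `[0, 1] &, {homo B : x y / x < y}}.
  move=> s t s01 t01 st; rewrite /B (bigD1 i0) //= [ltRHS](bigD1 i0) //=.
  apply: ltr_leD; first by rewrite ltrN2; exact: nI.
  by apply: ler_sum => i /andP[npi _]; rewrite lerN2 ltW //; exact: nI.
have AI : {in `[0, 1] &, {homo A : x y / x <= y}}.
  by move=> s t s01 t01 st; rewrite lerB //; apply: ler_sum => i pi; exact: pI.
(* Agreement of [A] and [B] at 0 and 1 puts the values of [A] in the range of [B] and fixes the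
   endpoints of [lam]. *)
have A0 : A 0 = B 0 by apply/AB; apply: eq_bigr => i _; rewrite if_same.
have A1 : A 1 = B 1 by apply/AB; rewrite G01; apply: eq_bigr => i _; rewrite if_same.
have Bc := Cm_on_continuous (Cm_pos_onW BC).
have [h [hK Kh hm hI hc]] := increasing_inverse ler01 Bc BI.
have Am s : s \in `[0, 1] -> A s \in `[B 0, B 1].
  move=> s01; move: (s01); rewrite in_itv /= => /andP[s0 s1].
  by rewrite in_itv /= -A0 -A1 !AI.
have hle : {in `[B 0, B 1] &, {mono h : x y / x <= y}} by exact: le_mono_in.
exists (fun s => h (A s)); split.
- apply: (@Cm_on_comp _ `[B 0, B 1]) => [s s01||].
  + exact: Am.
  + apply: Cm_pos_onW; apply: (Cm_pos_on_can _ _ hc BC) => y yB.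
      exact: hm.
    exact: Kh.
  + apply: Cm_onD; last exact: Cm_on_cst.
    by apply: Cm_on_sum => i; exact: pC.
- by rewrite A0 A1 !hK.
- by move=> s s01; apply: hm; exact: Am.
- by move=> s t s01 t01 st; rewrite hle ?Am // AI.
- by move=> s s01; apply/AB; rewrite Kh // Am.
Qed.

(** * Construction of the geodesic *)

Lemma is_interval_segment (R : realType) (J : set R) (u v s : R) :
  is_interval J -> J u -> J v -> s \in `[0, 1] -> J (u + s * (v - u)).
Proof.
move=> JI Ju Jv; rewrite in_itv /= => /andP[s0 s1].
by have [uv|vu] := leP u v; [apply: (JI u v)|apply: (JI v u)] => //; nra.
Qed.

(** Otherwise all differences [P 0 i - Q 0 i] are nonnegative with sum 0, hence all vanish. With [P]
    and [Q] exchanged it yields a falling coordinate. *)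
Lemma sum_eq_ex_lt (R : realType) (n : nat) (P Q : 'rV[R]_n) :
  \sum_i P 0 i = \sum_i Q 0 i -> P != Q -> exists i, P 0 i < Q 0 i.
Proof.
move=> PQ /eqP nPQ; apply/not_existsP => nlt; apply: nPQ; apply/rowP => i.
have QP j : 0 <= P 0 j - Q 0 j by rewrite subr_ge0 leNgt; apply/negP/nlt.
have /eqP : \sum_j (P 0 j - Q 0 j) = 0 by rewrite sumrB PQ subrr.
rewrite psumr_eq0 // => /allP /(_ i (mem_index_enum _)) /=.
by rewrite subr_eq0 => /eqP.
Qed.

Lemma Df_eq (R : realType) (f : R -> R) (N : nat) (P Q : 'rV[R]_N.+1) (j : 'I_N.+1) :
  (forall i, f (Q 0 i) - f (P 0 i) <= f (Q 0 j) - f (P 0 j)) ->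
  Df f P Q = f (Q 0 j) - f (P 0 j).
Proof.
move=> le_j; apply/eqP; rewrite eq_le; apply/andP; split.
  (* The starting value of the maximum is the term of index 0, so [le_j] bounds it too. *)
  by apply: bigmax_le => [|i _]; exact: le_j.
exact: (le_bigmax _ (fun i => f (Q 0 i) - f (P 0 i))).
Qed.

(** [I] is where [f] is regular. Being an interval, it contains everything between [P 0 i] and
    [Q 0 i], so no coordinate of the curve leaves it. *)
Lemma fgeodesic_Cm_in (R : realType) (N : nat) (f : R -> R) (I : set R) (m : nat)
    (P Q : 'rV[R]_N.+1) :
  {within `[0, 1], continuous f} -> {in `[0, 1] &, {homo f : x y / x < y}} ->
  is_interval I -> Cm_pos_on I m f -> simplex P -> simplex Q ->
  (forall i, I (P 0 i)) -> (forall i, I (Q 0 i)) ->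
  exists (a b : R) (g : R -> 'rV[R]_N.+1), fgeodesic f a b g P Q /\ Cm_on `[a, b] m g.
Proof.
move=> fc fI II fC [P01 sP] [Q01 sQ] IP IQ.
(* For [P = Q] the distance is 0 and time cannot be rescaled by it; the constant curve on [[0, 0]]
   serves. *)
have [<-|nPQ] := eqVneq P Q.
  exists 0, 0, (fun=> P).
  have gC k : Cm_on `[0, 0] k (fun=> P).
    have -> : (fun=> P) = (fun=> \row_i P 0 i) :> (R -> _).
      by apply/funext => _; apply/rowP => i; rewrite mxE.
    by apply: (@Cm_on_row _ _ _ _ (fun i => fun=> P 0 i)) => i; exact: Cm_on_cst.
  split=> //; split=> //; first exact: (gC 0).
  move=> s t; rewrite !in_itv /= -!eq_le => /eqP <- /eqP <- _.
  by rewrite (Df_eq (j := ord0)) ?subrr // => i; rewrite !subrr.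
have [F [fK Kf Fm FI Fc]] := increasing_inverse ler01 fc fI.
have Fle : {in `[f 0, f 1] &, {mono F : x y / x <= y}} by exact: le_mono_in.
have fle : {in `[0, 1] &, {mono f : x y / x <= y}} by exact: le_mono_in.
have i01 : (0 : R) \in `[0, 1] by rewrite in_itv /= lexx ler01.
have i11 : (1 : R) \in `[0, 1] by rewrite in_itv /= lexx ler01.
have fm x : x \in `[0, 1] -> f x \in `[f 0, f 1].
  by move=> x01; move: (x01); rewrite in_itv /= => /andP[x0 x1]; rewrite in_itv /= !fle ?x0.
(* The image under [f] of the part of [I] inside [[0, 1]]; there [F] inherits the class of [f]. *)
pose J := [set y | y \in `[f 0, f 1] /\ I (F y)].
have JI : is_interval J.
  move=> x y [x01 IFx] [y01 IFy] z /andP[xz zy].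
  have z01 : z \in `[f 0, f 1].
    move: x01 y01; rewrite !in_itv /= => /andP[? _] /andP[_ ?].
    by apply/andP; split; [exact: le_trans xz|exact: le_trans zy _].
  by split=> //; apply: (II (F x) (F y)) => //; rewrite !Fle // xz.
have FC : Cm_pos_on J m F.
  apply: (Cm_pos_on_can _ _ _ fC) => [y []//|y [+ _]|]; first exact: Kf.
  by apply: continuous_subspaceW Fc => y [].
have JP i : J (f (P 0 i)) by split; [exact: fm|rewrite fK].
have JQ i : J (f (Q 0 i)) by split; [exact: fm|rewrite fK].
(* [w i] is the straight segment in f-scale and [G i] the same motion in the original coordinate,
   both with time running over [[0, 1]]. *)
pose c i := f (Q 0 i) - f (P 0 i); pose w i s := f (P 0 i) + s * c i.
have Jw i s : s \in `[0, 1] -> J (w i s) by exact: is_interval_segment.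
pose p i := P 0 i <= Q 0 i; pose G i s := F (w i s).
have c0 i : (0 <= c i) = p i by rewrite subr_ge0 fle.
have cN i : ~~ p i -> c i < 0 by rewrite -c0 -ltNge.
have G0 i : G i 0 = P 0 i by rewrite /G /w mul0r addr0 fK.
have G1 i : G i 1 = Q 0 i by rewrite /G /w mul1r addrC subrK fK.
have GC i : Cm_on `[0, 1] m (G i).
  apply: (@Cm_on_comp _ J) => [s||]; [exact: Jw|exact: Cm_pos_onW|exact: Cm_on_affine].
have GI i : p i -> {in `[0, 1] &, {homo G i : s t / s <= t}}.
  move=> pi s t s01 t01 st; rewrite Fle ?(Jw _ _ _).1 //.
  by rewrite lerD2l ler_wpM2r // c0.
have GN i : ~~ p i -> {in `[0, 1] &, {homo G i : s t /~ s < t}}.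
  move=> /cN ci s t s01 t01 st; apply: FI; rewrite ?(Jw _ _ _).1 //.
  by rewrite ltrD2l ltr_nM2r.
have NGC i : ~~ p i -> Cm_pos_on `[0, 1] m (fun s => - G i s).
  by move=> /cN ci; apply: (Cm_pos_on_comp_affine _ ci FC) => s; exact: Jw.
have [i0 ni0] : exists i, ~~ p i.
  have sQP : \sum_i Q 0 i = \sum_i P 0 i by rewrite sP sQ.
  have [|i] := sum_eq_ex_lt sQP; first by rewrite eq_sym.
  by rewrite ltNge => ni; exists i.
have [j0 pj0] : exists j, P 0 j < Q 0 j.
  by apply: sum_eq_ex_lt => //; rewrite sP sQ.
have G01 : \sum_i G i 0 = \sum_i G i 1.
  by rewrite (eq_bigr _ (fun i _ => G0 i)) (eq_bigr _ (fun i _ => G1 i)) sP.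
have [lam [lamC [lam0 lam1] lam01 lamI lamE]] :=
  balancing_time (fun i _ => GC i) NGC GI GN (ex_intro _ i0 ni0) G01.
(* [c j] is the distance from [P] to [Q] and the length of the time interval; starting from the
   rising index [j0] shows that it is positive. *)
pose j := [arg max_(i > j0) c i]%O.
have jmax i : c i <= c j by rewrite /j; case: arg_maxP => // k _; exact.
have cj : 0 < c j by apply: lt_le_trans (jmax j0); rewrite subr_gt0 fI.
have pj : p j by rewrite -c0 ltW.
pose g t : 'rV[R]_N.+1 := \row_i G i (if p i then t / c j else lam (t / c j)).
have scale01 t : t \in `[0, c j] -> t / c j \in `[0, 1].
  rewrite !in_itv /= => /andP[t0 tc].
  by rewrite ler_pdivrMr // mul1r tc andbT divr_ge0 // ltW.
have tau01 i t : t \in `[0, c j] ->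
    (if p i then t / c j else lam (t / c j)) \in `[0, 1].
  by move=> /scale01 t01; case: ifP => // _; exact: lam01.
have giC i : Cm_on `[0, c j] m
    (fun t => G i (if p i then t / c j else lam (t / c j))).
  apply: (@Cm_on_comp _ `[0, 1]) => [t|//|]; first exact: tau01.
  have sC : Cm_on `[0, c j] m (fun t => t / c j).
    by apply: Cm_onM; [exact: Cm_on_id|exact: Cm_on_cst].
  case: (boolP (p i)) => // _.
  by apply: (@Cm_on_comp _ `[0, 1]) sC => // t; exact: scale01.
exists 0, (c j), g; split; last exact: Cm_on_row giC.
split; first exact: ltW.
- by apply: (@Cm_on_row _ _ _ 0) => i; exact: Cm_on_continuous (giC i).
- move=> t t01; split=> [i|]; first by rewrite mxE; apply: Fm; apply: (Jw _ _ _).1; exact: tau01.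
  under eq_bigr do rewrite mxE.
  by rewrite lamE ?scale01 // (eq_bigr _ (fun i _ => G0 i)).
- split; apply/rowP => i; rewrite mxE.
    by rewrite mul0r lam0 if_same.
  by rewrite divff ?gt_eqF // lam1 if_same.
- move=> s t s01 t01 st.
  have fg i r : r \in `[0, c j] ->
      f (g r 0 i) = w i (if p i then r / c j else lam (r / c j)).
    by move=> r01; rewrite mxE Kf //; apply: (Jw _ _ _).1; exact: tau01.
  have fgE i : f (g t 0 i) - f (g s 0 i) =
      (if p i then (t - s) / c j else lam (t / c j) - lam (s / c j)) * c i.
    by rewrite !fg // /w; case: ifP => _; ring.
  have fgj : f (g t 0 j) - f (g s 0 j) = t - s by rewrite fgE pj divfK ?gt_eqF.
  (* The coordinate [j] has unit speed in f-scale; a rising [i] has speed [c i / c j], at most 1. *)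
  rewrite (Df_eq (j := j)) fgj // => i; rewrite fgE.
  have [pi|npi] := boolP (p i).
    by rewrite mulrAC ler_pdivrMr // ler_wpM2l ?subr_ge0.
  (* A falling coordinate contributes a nonnegative increment of [lam] times a negative [c i], which
     is at most 0. *)
  have : lam (s / c j) <= lam (t / c j).
    by apply: lamI; rewrite ?scale01 // ler_pM2r ?invr_gt0.
  by have := cN i npi; nra.
Qed.

(** * From ordinary derivatives to derivatives relative to a set *)

(** The substitution [h = y - x] carries the limit at 0 to one at [x], and restricting to [A] only
    shrinks the set of approach. *)
Lemma derivable_is_derivative_on (R : realType) (A : set R) (g : R -> R) :
  (forall x, A x -> derivable g x 1) -> is_derivative_on A g g^`()%classic.
Proof.
move=> gD x Ax W dW.
have dg : (fun h => h^-1 *: (g (h + x) - g x)) @ 0^' --> g^`()%classic x.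
  rewrite derive1E.
  have -> : (fun h => h^-1 *: (g (h + x) - g x)) =
      (fun h => h^-1 *: ((g \o shift x) (h *: 1) - g x)).
    by apply/funext => h; rewrite /= [_%:A]mulr1.
  exact: gD x Ax.
have W0 : nbhs (0 : R) [set h | h != 0 -> W (h^-1 *: (g (h + x) - g x))].
  exact: dg W dW.
have sub_x : (fun y => y - x) @ x --> (0 : R).
  by rewrite -[X in _ --> X](subrr x); apply: cvgB => //; exact: cvg_cst.
have Wx : nbhs x [set y | y - x != 0 -> W ((y - x)^-1 *: (g (y - x + x) - g x))].
  exact: sub_x _ W0.
apply: (filterS _ Wx) => y /= Wy nyx _.
by have := Wy; rewrite subrK subr_eq0; exact.
Qed.

Lemma Cm_01_Cm_pos_on (R : realType) (m : nat) (f : R -> R) :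
  (1 <= m)%N -> Cm_01 m f -> {in `]0, 1[, forall x, 0 < (f^`())%classic x} ->
  Cm_pos_on `]0, 1[ m f.
Proof.
case: m => // m _ [fD fc] f0.
(* [n] derivatives are already taken and [k] remain; [m] is now the predecessor of the original
   exponent, so the total is [m.+1]. *)
have fCk k n : (k + n = m.+1)%N -> Cm_on `]0, 1[ k (f^`(n))%classic.
  elim: k n => [|k IH] n.
    rewrite add0n => ->; apply/subspace_continuousP => x x01.
    apply: cvg_within_filter; exact: fc.
  move=> knm; exists (f^`(n.+1))%classic; split; last by apply: IH; rewrite addnS.
  rewrite derive1nS; apply: derivable_is_derivative_on => x x01.
  by apply: fD => //; rewrite -knm ltnS leq_addl.
exists (f^`())%classic; split=> //.
- by apply: derivable_is_derivative_on => x x01; exact: (fD 0).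
- by rewrite -derive1n1; apply: fCk; rewrite addn1.
Qed.

(** Since [1 <= N] there is a second coordinate, [lift i ord0]; its positive mass keeps [P 0 i]
    below 1. *)
Lemma simplex_interior_itv (R : realType) (N : nat) (P : 'rV[R]_N.+1) :
  (1 <= N)%N -> simplex_interior P -> forall i, P 0 i \in `]0, 1[.
Proof.
case: N P => // n P _ [[_ sP] P0] i; rewrite in_itv /= P0 /= -sP.
rewrite (bigD1 i) //= ltrDl (bigD1 (lift i ord0)) ?neq_lift //=; last first.
  by rewrite eq_sym neq_lift.
by apply: ltr_wpDr => //; apply: sumr_ge0 => k _; exact: ltW.
Qed.

Theorem theorem3p6 (R : realType) (N : nat) (hN : (1 <= N)%N) (f : R -> R)
    (f_cont : {within `[0, 1], continuous f})
    (f_incr : {in `[0, 1] &, {homo f : x y / x < y}}) :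
  (forall P Q : 'rV[R]_N.+1, simplex P -> simplex Q ->
     exists (a b : R) (g : R -> 'rV[R]_N.+1), fgeodesic f a b g P Q) /\
  (forall m : nat, (1 <= m)%N -> Cm_01 m f ->
     {in `]0, 1[, forall x, 0 < (f^`())%classic x} ->
     forall P Q : 'rV[R]_N.+1, simplex_interior P -> simplex_interior Q ->
       exists (a b : R) (g : R -> 'rV[R]_N.+1),
         fgeodesic f a b g P Q /\ Cm_on `[a, b] m g).
Proof.
split=> [P Q sP sQ|m m1 fm f0 P Q iP iQ].
  (* With [m = 0] the regularity required on [[0, 1]] is just [f_cont]. *)
  have [||a [b [g [gG _]]]] := @fgeodesic_Cm_in R N f `[0, 1] 0 P Q f_cont f_incr
    (@interval_is_interval _ _) f_cont sP sQ.
  - by have [] := sP.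
  - by have [] := sQ.
  - by exists a, b, g.
apply: (@fgeodesic_Cm_in R N f `]0, 1[) => //.
- exact: interval_is_interval.
- exact: Cm_01_Cm_pos_on.
- by case: iP.
- by case: iQ.
- exact: simplex_interior_itv.
- exact: simplex_interior_itv.
Qed.
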